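(* Let $p\ge1$, $\varepsilon>0$, and let $X\subset\mathbb{R}^d$ be a finite set of points with nonnegative weights $w$. Let $\varphi:X\to\mathbb{R}^m$ be a map (with $\varphi(x)$ carrying weight $w(x)$) whose distortion graph $G$ on $X$ is $\alpha$-everywhere sparse with respect to $w$, where $\alpha\le1/10^{p+1}$. Let $D=(1+\varepsilon)^p(1+3^{p+2}\alpha^{1/(p+1)})$. Then \[\frac1D\,\mathrm{cost}_p(X)\le\mathrm{cost}_p(\varphi(X))\le D\,\mathrm{cost}_p(X).\]
   Context: $\mathrm{cost}_p(X)=\min_{c\in\mathbb{R}^d}\sum_{x\in X}w(x)\|x-c\|^p$ and $\mathrm{cost}_p(\varphi(X))=\min_{c\in\mathbb{R}^m}\sum_{x\in X}w(x)\|\varphi(x)-c\|^p$ (Euclidean norms). The distortion graph of $\varphi$ has vertex set $X$ and an edge between $x,y$ if the distance between $x,y$ is distorted by a factor at least $1+\varepsilon$, i.e. $\|\varphi(x)-\varphi(y)\|$ is not within $[(1+\varepsilon)^{-1}\|x-y\|,(1+\varepsilon)\|x-y\|]$. A vertex-weighted graph $G=(V,E)$ is $\alpha$-everywhere sparse if $\sum_{v\in N(u)}w(v)\le\alpha\sum_{v\in V}w(v)$ for every $u\in V$, where $N(u)$ is the neighborhood of $u$. *)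

(* Defs.v *)
From HB Require Import structures.
From mathcomp Require Import all_boot all_order all_algebra finmap.
From mathcomp Require Import all_classical all_reals all_analysis.

Set Implicit Arguments.
Unset Strict Implicit.
Unset Printing Implicit Defensive.

Import Order.TTheory GRing.Theory Num.Theory.
Import numFieldNormedType.Exports.

Local Open Scope classical_set_scope.
Local Open Scope ring_scope.

(* The library norm `|v| on 'rV[R]_n is the sup norm, hence this definition. *)
Definition enorm (R : realType) (n : nat) (v : 'rV[R]_n) : R :=
  Num.sqrt (\sum_(i < n) v ord0 i ^+ 2).

(* A weighted point set is given by an indexing x : T -> 'rV[R]_n, so that
   the points of an image phi(X) are counted with multiplicity. *)
Definition cost_at (R : realType) (T : finType) (n : nat) (p : R)
    (w : T -> R) (x : T -> 'rV[R]_n) (c : 'rV[R]_n) : R :=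
  \sum_(t : T) w t * enorm (x t - c) `^ p.

(* The infimum is a minimum for nonnegative weights: see cost_attained. *)
Definition cost (R : realType) (T : finType) (n : nat) (p : R)
    (w : T -> R) (x : T -> 'rV[R]_n) : R :=
  inf (range (cost_at p w x)).

Definition distortion_graph (R : realType) (T : finType) (d m : nat) (eps : R)
    (x : T -> 'rV[R]_d) (y : T -> 'rV[R]_m) : rel T :=
  fun s t =>
    ~~ ((1 + eps)^-1 * enorm (x s - x t) <= enorm (y s - y t)
        <= (1 + eps) * enorm (x s - x t)).

Definition everywhere_sparse (R : realType) (V : finType) (w : V -> R)
    (alpha : R) (E : rel V) : Prop :=
  forall u : V, \sum_(v | E u v) w v <= alpha * \sum_v w v.

Section CostAttained.
Variable R : realType.

Lemma enorm_ge0 n (v : 'rV[R]_n) : 0 <= enorm v.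
Proof. exact: sqrtr_ge0. Qed.

Lemma coord_le_enorm n (v : 'rV[R]_n) i : `|v ord0 i| <= enorm v.
Proof.
rewrite -sqrtr_sqr /enorm; apply: ler_wsqrtr.
by rewrite (bigD1 i)//= lerDl sumr_ge0// => j _; exact: sqr_ge0.
Qed.

Lemma norm_le_enorm n (v : 'rV[R]_n) : `|v| <= enorm v.
Proof.
have [->|v0] := eqVneq (`|v|) 0; first exact: enorm_ge0.
have [[i j] /= vij] := mx_norm_neq0 v0.
rewrite [leLHS]vij.
by rewrite (ord1 i); exact: coord_le_enorm.
Qed.

Lemma enorm_continuous n : continuous (@enorm R n).
Proof.
move=> v; apply: (@continuous_comp _ _ _
  (fun v : 'rV[R]_n => \sum_(i < n) v ord0 i ^+ 2) (@Num.sqrt R));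
  last exact: sqrt_continuous.
apply: cvg_big => [||i _]; [exact: add_continuous|exact: nbhs_filter|].
apply: (@continuous_comp _ _ _ (fun v : 'rV[R]_n => v ord0 i) (fun y => y ^+ 2)).
  exact: coord_continuous.
exact: exprn_continuous.
Qed.

Lemma cvg_powR_ge0 (p a : R) : 1 <= p -> 0 <= a ->
  `|y| `^ p @[y --> a] --> a `^ p.
Proof.
move=> p1; rewrite le_eqVlt => /predU1P[<-|a0].
  rewrite powR0; last by rewrite gt_eqF// (lt_le_trans _ p1).
  apply: (@squeeze_cvgr _ _ _ _ (fun=> 0) (fun y : R => `|y|)).
  - near=> y; rewrite powR_ge0/=.
    have y1 : `|y| <= 1.
      near: y; apply/nbhs_ballP; exists 1 => //= y.
      by rewrite /ball/= sub0r normrN => /ltW.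
    have [->|y0] := eqVneq y 0.
      by rewrite normr0 powR0// gt_eqF// (lt_le_trans _ p1).
    rewrite -[leRHS]powRr1//; apply: ger_powR => //.
    by rewrite y1 normr_gt0 y0.
  - exact: cvg_cst.
  - rewrite -[X in _ --> X](@normr0 _ R); exact: norm_continuous.
rewrite -{2}(gtr0_norm a0).
apply: (@continuous_comp _ _ _ (fun y : R => `|y|) (fun y => y `^ p)).
  exact: norm_continuous.
apply: differentiable_continuous; apply/derivable1_diffP.
by apply: derivable_powR; rewrite in_itv/= andbT gtr0_norm.
Unshelve. all: by end_near. Qed.

Lemma enorm_sub_continuous n (x : 'rV[R]_n) :
  continuous (fun c : 'rV[R]_n => enorm (x - c)).
Proof.
move=> c; apply: (@continuous_comp _ _ _ (fun y : 'rV[R]_n => x - y) (@enorm R n)).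
  apply: (@continuousB R 'rV[R]_n _ (fun=> x) id) => //; exact: cst_continuous.
exact: enorm_continuous.
Qed.

Lemma enorm_powR_continuous n p (x : 'rV[R]_n) : 1 <= p ->
  continuous (fun c : 'rV[R]_n => enorm (x - c) `^ p).
Proof.
move=> p1 c.
have -> : (fun c : 'rV[R]_n => enorm (x - c) `^ p) =
    (fun y : R => `|y| `^ p) \o (fun c => enorm (x - c)).
  by apply/funext => y /=; rewrite ger0_norm// enorm_ge0.
apply: continuous_comp; first exact: enorm_sub_continuous.
have := cvg_powR_ge0 p1 (enorm_ge0 (x - c)).
by rewrite -{2}(ger0_norm (enorm_ge0 (x - c))).
Qed.

Lemma cost_at_continuous (T : finType) n p (w : T -> R) (x : T -> 'rV[R]_n) :
  1 <= p -> continuous (cost_at p w x).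
Proof.
move=> p1.
have cF t : continuous (fun c : 'rV[R]_n => w t * enorm (x t - c) `^ p).
  move=> c; apply: (@continuous_comp _ _ _
    (fun c : 'rV[R]_n => enorm (x t - c) `^ p) ( *%R (w t))).
    exact: enorm_powR_continuous.
  exact: mulrl_continuous.
by apply: continuous_big => [|t _]; [exact: add_continuous|exact: cF].
Qed.

Lemma cost_attained (T : finType) n p (w : T -> R) (x : T -> 'rV[R]_n) :
  1 <= p -> (forall t, 0 <= w t) ->
  exists2 c, cost p w x = cost_at p w x c
           & forall c', cost_at p w x c <= cost_at p w x c'.
Proof.
move=> p1 w0; set f := cost_at p w x.
suff [c fc] : exists c, forall c', f c <= f c'.
  exists c => //; apply/eqP; rewrite eq_le; apply/andP; split.
    apply: ge_inf; last by exists c.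
    by exists (f c) => _ [c' _ <-].
  apply: lb_le_inf; first by exists (f c); exists c.
  by move=> _ [c' _ <-].
have term_ge0 c t : 0 <= w t * enorm (x t - c) `^ p by rewrite mulr_ge0// powR_ge0.
have [/existsP[t0 wt0]|] := boolP [exists t, 0 < w t]; last first.
  rewrite negb_exists => /forallP wle0.
  have wz t : w t = 0 by apply/eqP; rewrite eq_le w0 leNgt wle0.
  by exists 0 => c'; rewrite /f /cost_at !big1// => t _; rewrite wz mul0r.
pose A := [set c | f c <= f 0].
have cf : continuous f by exact: cost_at_continuous.
have clA : closed A.
  by apply: (@closed_comp _ _ f [set y | y <= f 0]) => [? _|]; [exact: cf|exact: closed_le].
have bA : bounded_set A.
  pose M := `|x t0| + (1 + f 0 / w t0).
  have MA c : A c -> `|c| <= M.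
    move=> Ac; rewrite -[c](subKr (x t0)) (le_trans (ler_normB _ _))// lerD2l.
    apply: le_trans (norm_le_enorm _) _.
    have h : enorm (x t0 - c) `^ p <= f 0 / w t0.
      rewrite ler_pdivlMr// mulrC; apply: le_trans Ac.
      by rewrite /f /cost_at (bigD1 t0)//= lerDl sumr_ge0.
    have [le1|gt1] := leP (enorm (x t0 - c)) 1.
      by rewrite (le_trans le1)// lerDl (le_trans (powR_ge0 _ _) h).
    apply: le_trans (_ : f 0 / w t0 <= _); last by rewrite lerDr.
    apply: le_trans h; rewrite -[leLHS]powRr1 ?enorm_ge0//.
    by apply: ler_powR => //; exact: ltW.
  exists M; split; first exact: num_real.
  by move=> y My c /MA /le_trans; apply; exact: ltW.
have A0 : A !=set0 by exists 0; rewrite /A/=.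
have [c cA fc] := compact_EVT_min A0 (bounded_closed_compact bA clA)
  (continuous_subspaceT cf).
exists c => c'; have [c'A|/ltW c'A] := leP (f c') (f 0); first by apply: fc; rewrite inE.
by apply: le_trans c'A; apply: fc; rewrite inE /A/=.
Qed.

End CostAttained.

(* Main.v *)
Require Import Defs.
From HB Require Import structures.
From mathcomp Require Import all_boot all_order all_algebra finmap.
From mathcomp Require Import all_classical all_reals all_analysis.
From mathcomp Require Import ring lra.

Set Implicit Arguments.
Unset Strict Implicit.
Unset Printing Implicit Defensive.

Import Order.TTheory GRing.Theory Num.Theory.
Import numFieldNormedType.Exports.

Local Open Scope classical_set_scope.
Local Open Scope ring_scope.

(** Up to exchanging the roles of [X] and [phi(X)] only the upper bound is needed.
    Fix an optimal center [c] of [X] and put [r t = |x t - c|], [L = 1 + eps],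
    [th = alpha^(1/(p+1))] and [beta = th^p], so that [alpha / beta = th].
    A robust form of Kirszbraun's one-point extension gives [c'] with
    [|y t - c'|^2 <= L^2 (1 + 8 th) r_t^2] outside a set of weight at most
    [(beta + 2 alpha) W], [W] being the total weight: [c'] is the mean of [y] under a
    distribution [l <= w / (beta W)] that is optimal in a quadratic minimax problem.
    By the variance identity its value is governed by the pairwise distances; under [l]
    every vertex has distorted neighbours of mass at most [alpha / beta], and across a
    distorted edge the distance is controlled through a common non-neighbour close to
    [c]. Each exceptional [t] is linked to a good non-neighbour [u] whose [r u] is at
    most average, whence [|y t - c'| <= L (r t + 12/5 r u)]; as their total weight is
    about [th^p W], convexity of the [p]-th power makes their contribution [O(th)]
    relative to the cost. *)

(** * Cauchy-Schwarz and triangle inequalities for the Euclidean norm *)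

Section EuclideanNorm.
Variable R : realType.

Lemma enorm_sqr n (v : 'rV[R]_n) : enorm v ^+ 2 = \sum_(i < n) v ord0 i ^+ 2.
Proof. by rewrite sqr_sqrtr// sumr_ge0// => i _; exact: sqr_ge0. Qed.

Lemma enormN n (v : 'rV[R]_n) : enorm (- v) = enorm v.
Proof. by congr Num.sqrt; apply: eq_bigr => i _; rewrite mxE sqrrN. Qed.

Lemma enormB n (u v : 'rV[R]_n) : enorm (u - v) = enorm (v - u).
Proof. by rewrite -enormN opprB. Qed.

(** Expand the nonnegative squared norm of [enorm v *: u - enorm u *: v]. *)
Lemma enorm_cauchy_schwarz n (u v : 'rV[R]_n) :
  \sum_(i < n) u ord0 i * v ord0 i <= enorm u * enorm v.
Proof.
have [/eqP|uv0] := eqVneq (enorm u * enorm v) 0.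
  rewrite mulf_eq0 => uv0; rewrite (le_trans (_ : _ <= 0))//; last first.
    by rewrite mulr_ge0// enorm_ge0.
  rewrite big1// => i _; have [/eqP u0|/eqP v0] := orP uv0.
    by have := coord_le_enorm u i; rewrite u0 normr_le0 => /eqP ->; rewrite mul0r.
  by have := coord_le_enorm v i; rewrite v0 normr_le0 => /eqP ->; rewrite mulr0.
have uv_gt0 : 0 < enorm u * enorm v.
  by rewrite lt_neqAle eq_sym uv0 mulr_ge0// enorm_ge0.
have : 0 <= \sum_(i < n) (enorm v * u ord0 i - enorm u * v ord0 i) ^+ 2.
  by apply: sumr_ge0 => i _; exact: sqr_ge0.
have -> : \sum_(i < n) (enorm v * u ord0 i - enorm u * v ord0 i) ^+ 2 =
    2 * (enorm u * enorm v) *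
    (enorm u * enorm v - \sum_(i < n) u ord0 i * v ord0 i).
  transitivity (enorm v ^+ 2 * (\sum_(i < n) u ord0 i ^+ 2) +
    enorm u ^+ 2 * (\sum_(i < n) v ord0 i ^+ 2) -
    2 * (enorm u * enorm v) * \sum_(i < n) u ord0 i * v ord0 i).
    rewrite !mulr_sumr -big_split/= -sumrB.
    by apply: eq_bigr => i _; ring.
  by rewrite -!enorm_sqr; ring.
by rewrite pmulr_rge0 ?subr_ge0// mulr_gt0.
Qed.

Lemma enorm_triangle n (u v : 'rV[R]_n) : enorm (u + v) <= enorm u + enorm v.
Proof.
rewrite -(@ler_pXn2r _ 2)// ?nnegrE ?addr_ge0 ?enorm_ge0// enorm_sqr.
have -> : \sum_(i < n) (u + v) ord0 i ^+ 2 =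
    enorm u ^+ 2 + 2 * (\sum_(i < n) u ord0 i * v ord0 i) + enorm v ^+ 2.
  rewrite !enorm_sqr mulr_sumr -!big_split/=.
  by apply: eq_bigr => i _; rewrite !mxE; ring.
by have := enorm_cauchy_schwarz u v; nra.
Qed.

Lemma enorm_triangleB n (u v z : 'rV[R]_n) :
  enorm (u - z) <= enorm (u - v) + enorm (v - z).
Proof. by rewrite -{1}(subrKA v); exact: enorm_triangle. Qed.

End EuclideanNorm.

(** * Variance identities and a quadratic minimax problem over distributions *)

Section WeightedMean.
Variables (R : realType) (T : finType).
Implicit Types (l : T -> R).

Definition wmean n l (y : T -> 'rV[R]_n) : 'rV[R]_n := \sum_t l t *: y t.

Lemma wmean_coord n l (y : T -> 'rV[R]_n) i :
  wmean l y ord0 i = \sum_t l t * y t ord0 i.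
Proof. by rewrite summxE; apply: eq_bigr => t _; rewrite mxE. Qed.

(** Steiner's identity: both sides equal the variance of [y] under [l], summed over coordinates,
    where the centre no longer appears. *)
Lemma wmean_parallel_axis n l (y : T -> 'rV[R]_n) c c' : \sum_t l t = 1 ->
  \sum_t l t * enorm (y t - c) ^+ 2 - enorm (wmean l y - c) ^+ 2 =
  \sum_t l t * enorm (y t - c') ^+ 2 - enorm (wmean l y - c') ^+ 2.
Proof.
move=> l1.
have H b : \sum_t l t * enorm (y t - b) ^+ 2 - enorm (wmean l y - b) ^+ 2 =
    \sum_(i < n) (\sum_t l t * y t ord0 i ^+ 2 - wmean l y ord0 i ^+ 2).
  under eq_bigr do rewrite enorm_sqr mulr_sumr.
  rewrite exchange_big enorm_sqr -sumrB/=; apply: eq_bigr => i _.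
  rewrite !mxE.
  have -> : \sum_t l t * (y t - b) ord0 i ^+ 2 = \sum_t l t * y t ord0 i ^+ 2 -
      2 * b ord0 i * wmean l y ord0 i + b ord0 i ^+ 2 * \sum_t l t.
    rewrite wmean_coord !mulr_sumr -sumrB -big_split/=.
    by apply: eq_bigr => t _; rewrite !mxE; ring.
  by rewrite l1; ring.
by rewrite !H.
Qed.

(** For fixed [s], the parallel axis identity with centre [y s] turns the inner sum into the
    variance plus [enorm (wmean l y - y s) ^+ 2]; averaging over [s] yields the variance a second
    time. *)
Lemma wmean_pairwise n l (y : T -> 'rV[R]_n) c : \sum_t l t = 1 ->
  \sum_s \sum_t l s * l t * enorm (y s - y t) ^+ 2 =
  2 * (\sum_t l t * enorm (y t - c) ^+ 2 - enorm (wmean l y - c) ^+ 2).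
Proof.
move=> l1; set V := (X in 2 * X).
have H s : \sum_t l t * enorm (y s - y t) ^+ 2 = V + enorm (wmean l y - y s) ^+ 2.
  rewrite /V (wmean_parallel_axis y c (y s) l1) subrK.
  by apply: eq_bigr => t _; rewrite enormB.
under eq_bigr do (under eq_bigr do rewrite -mulrA; rewrite -mulr_sumr H mulrDr enormB).
rewrite big_split/= -mulr_suml l1 mul1r mulr_natl mulr2n; congr (_ + _).
by rewrite /V (wmean_parallel_axis y c (wmean l y) l1) subrr enorm_sqr
  [X in _ - X]big1 ?subr0// => i _; rewrite mxE expr0n.
Qed.

Definition capped_distribution (u l : T -> R) :=
  (forall t, 0 <= l t <= u t) /\ \sum_t l t = 1.

(** Extreme value theorem on the compact set of capped distributions. *)
Lemma capped_distribution_maximizer (u a : T -> R) n (y : T -> 'rV[R]_n) l0 :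
  capped_distribution u l0 ->
  let f l := \sum_t l t * a t - enorm (wmean l y) ^+ 2 in
  exists2 l, capped_distribution u l &
    forall l', capped_distribution u l' -> f l' <= f l.
Proof.
move=> [l0u l01] f.
(* Distributions are encoded as row vectors, where closed bounded sets are compact. *)
pose fn (v : 'rV[R]_#|T|) (t : T) := v ord0 (enum_rank t).
have cfn t : continuous (fn^~ t) by move=> v; exact: coord_continuous.
have cvgsum (F : T -> 'rV[R]_#|T| -> R) : (forall t, continuous (F t)) ->
    continuous (fun v => \sum_t F t v).
  by move=> cF; apply: continuous_big => [|t _]; [exact: add_continuous|exact: cF].
have cvgM (g : 'rV[R]_#|T| -> R) b : continuous g -> continuous (fun v => g v * b).
  move=> cg v; apply: (@continuous_comp _ _ _ g ( *%R^~ b)); first exact: cg.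
  exact: mulrr_continuous.
pose A := [set v | capped_distribution u (fn v)].
have fnK l : fn (\row_i l (enum_val i)) = l.
  by apply/funext => t; rewrite /fn mxE enum_rankK.
have A0 : A !=set0 by exists (\row_i l0 (enum_val i)); rewrite /A/= fnK.
have clA : closed A.
  have -> : A = (\bigcap_t [set v | fn v t \in `[0, u t]]) `&`
      [set v | \sum_t fn v t = 1].
    apply/seteqP; split=> [v [h1 h2]|v [h1 h2]]; split => //.
      by move=> t _ /=; rewrite in_itv/=; exact: h1.
    by move=> t; have := h1 t I; rewrite /= in_itv.
  apply: closedI.
    apply: closed_bigI => t _.
    by apply: (@closed_comp _ _ (fn^~ t) [set x | x \in `[0, u t]]) => [? _|];
      [exact: cfn|exact: itv_closed].
  by apply: (@closed_comp _ _ (fun v => \sum_t fn v t) [set x | x = 1]) => [? _|];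
    [exact: cvgsum|exact: closed_eq].
have bA : bounded_set A.
  exists (\sum_t `|u t|); split; first exact: num_real.
  move=> M uM v [vu _]; apply: le_trans (ltW uM).
  have [->|v0] := eqVneq (`|v|) 0; first by rewrite sumr_ge0.
  have [[i j] /= vij] := mx_norm_neq0 v0; rewrite [leLHS]vij (ord1 i).
  have /andP[vj0 vju] := vu (enum_val j).
  rewrite /fn enum_valK in vj0 vju.
  rewrite ger0_norm// (le_trans vju)// (le_trans (ler_norm _))//.
  by rewrite (bigD1 (enum_val j))//= lerDl sumr_ge0.
have cf : continuous (f \o fn).
  move=> v; apply: (@continuousB _ _ _ (fun v => \sum_t fn v t * a t)
      (fun v => enorm (wmean (fn v) y) ^+ 2)).
    by apply: cvgsum => t; exact: cvgM.
  have -> : (fun v => enorm (wmean (fn v) y) ^+ 2) =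
      (fun v => \sum_i (\sum_t fn v t * y t ord0 i) ^+ 2).
    by apply/funext => z; rewrite enorm_sqr; apply: eq_bigr => i _; rewrite wmean_coord.
  apply: cvg_big => [||i _]; [exact: add_continuous|exact: nbhs_filter|].
  apply: (@continuous_comp _ _ _ (fun v => \sum_t fn v t * y t ord0 i) (fun z => z ^+ 2)).
    by apply: cvgsum => t; exact: cvgM.
  exact: exprn_continuous.
have [v vA vmax] := compact_EVT_max A0 (bounded_closed_compact bA clA)
  (continuous_subspaceT cf).
exists (fn v); first by move: vA; rewrite inE.
move=> l' l'u; have := vmax (\row_i l' (enum_val i)).
by rewrite inE /A/= fnK; exact.
Qed.

(* [l] maximises the concave function [l |-> min_c \sum_t l t * (enorm (y t - c) ^+ 2 - k t)],
   and the conclusion is its first-order optimality condition. *)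
Lemma quadratic_minimax (u k : T -> R) n (y : T -> 'rV[R]_n) l0 :
  capped_distribution u l0 ->
  exists2 l, capped_distribution u l &
    forall l', capped_distribution u l' ->
      \sum_t l' t * (enorm (y t - wmean l y) ^+ 2 - k t) <=
      \sum_t l t * (enorm (y t - wmean l y) ^+ 2 - k t).
Proof.
move=> /(@capped_distribution_maximizer u (fun t => enorm (y t - 0) ^+ 2 - k t) n y).
move=> [l lu lmax]; exists l => // l' l'u.
set c := wmean l y; pose g t := enorm (y t - c) ^+ 2 - k t.
have fE h : capped_distribution u h ->
    \sum_t h t * (enorm (y t - 0) ^+ 2 - k t) - enorm (wmean h y) ^+ 2 =
    \sum_t h t * g t - enorm (wmean h y - c) ^+ 2.
  move=> [_ h1]; have := wmean_parallel_axis y 0 c h1; rewrite subr0 => E.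
  under eq_bigr do rewrite mulrBr; under [in RHS]eq_bigr do rewrite mulrBr.
  by rewrite !sumrB addrAC E addrAC.
set G := \sum_t (l' t - l t) * g t.
suff : G <= 0.
  by rewrite /G; under eq_bigr do rewrite mulrBl; rewrite sumrB subr_le0.
set N := enorm (wmean l' y - c) ^+ 2.
have N0 : 0 <= N by exact: sqr_ge0.
(* Moving from [l] a fraction [e] of the way to [l'] changes the objective by [e * G - e ^+ 2 * N],
   which is nonpositive because [l] is a maximizer. *)
have step e : 0 < e <= 1 -> G <= e * N.
  move=> /andP[e0 e1]; pose h t := l t + e * (l' t - l t).
  have hu : capped_distribution u h.
    split=> [t|].
      have /andP[? ?] := lu.1 t; have /andP[? ?] := l'u.1 t.
      by rewrite /h; apply/andP; split; nra.
    rewrite big_split/= -mulr_sumr sumrB lu.2 l'u.2; ring.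
  have := lmax h hu; rewrite !fE// subrr (_ : enorm 0 = 0); last first.
    by rewrite /enorm big1 ?sqrtr0// => i _; rewrite mxE expr0n.
  rewrite expr0n/= subr0.
  have -> : wmean h y - c = e *: (wmean l' y - c).
    rewrite /wmean; under eq_bigr do rewrite scalerDl.
    rewrite big_split/= addrAC subrr add0r.
    under eq_bigr do rewrite -scalerA scalerBl.
    by rewrite -scaler_sumr sumrB.
  have -> : enorm (e *: (wmean l' y - c)) ^+ 2 = e * (e * N).
    rewrite /N !enorm_sqr !mulr_sumr; apply: eq_bigr => i _.
    by rewrite !mxE; ring.
  have -> : \sum_t h t * g t = \sum_t l t * g t + e * G.
    rewrite /G mulr_sumr -big_split/=; apply: eq_bigr => t _; rewrite /h; ring.
  by rewrite -addrA gerDl -mulrBr pmulr_rle0// subr_le0.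
(* A positive [G] is refuted by [e = G / (N + G + 1)], for which [e * N < G]. *)
rewrite leNgt; apply/negP => G0.
have /step : 0 < G / (N + G + 1) <= 1.
  by rewrite divr_gt0 ?ler_pdivrMr; lra.
rewrite mulrAC ler_pdivlMr; nra.
Qed.

End WeightedMean.

(** * Weights of subsets and averaging arguments *)

Section WeightSums.
Variables (R : realType) (T : finType) (w : T -> R).
Hypothesis w_ge0 : forall t, 0 <= w t.

Lemma weight_subset (P Q : pred T) : (forall t, P t -> Q t) ->
  \sum_(t | P t) w t <= \sum_(t | Q t) w t.
Proof.
move=> PQ; rewrite big_mkcond [leRHS]big_mkcond/=; apply: ler_sum => t _.
by case: ifP => [/PQ ->//|_]; case: ifP.
Qed.

Lemma weight_union (P Q : pred T) :
  \sum_(t | P t || Q t) w t <= \sum_(t | P t) w t + \sum_(t | Q t) w t.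
Proof.
rewrite big_mkcond [in leRHS]big_mkcond [X in _ + X]big_mkcond -big_split/=.
apply: ler_sum => t _; have := w_ge0 t.
by case: (P t); case: (Q t) => /=; lra.
Qed.

Lemma weight_compl (P : pred T) :
  \sum_(t | P t) w t + \sum_(t | ~~ P t) w t = \sum_t w t.
Proof. by rewrite [in RHS](bigID P). Qed.

Lemma heavier_witness (P N : pred T) :
  \sum_(t | N t) w t < \sum_(t | P t) w t -> exists2 t, P t & ~~ N t.
Proof.
move=> NP; have [/existsP[t /andP[]]|] := boolP [exists t, P t && ~~ N t].
  by exists t.
rewrite negb_exists => /forallP h; move: NP; rewrite ltNge weight_subset// => t Pt.
by have := h t; rewrite Pt/= negbK.
Qed.

(** All the points concerned lie in the sublevel set of the one among them with largest [r]. *)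
Lemma small_sublevel_weight (r : T -> R) (a : R) : 0 <= a ->
  \sum_(t | \sum_(s | r s <= r t) w s <= a) w t <= a.
Proof.
move=> a0; pose P t := \sum_(s | r s <= r t) w s <= a.
have [/existsP[t0 Pt0]|] := boolP [exists t, P t]; last first.
  by rewrite negb_exists => /forallP h; rewrite big_pred0// => t; exact/negbTE/h.
have [t Pt tmax] := @arg_maxP _ _ _ t0 P r Pt0.
by apply: le_trans Pt; apply: weight_subset => s /tmax.
Qed.

(** Markov-type argument: the minimum of [f] over [P], times [M], is at most [C]. *)
Lemma le_average_witness (P : pred T) (f : T -> R) (C M : R) :
  (forall t, 0 <= f t) -> \sum_t w t * f t <= C ->
  0 < M <= \sum_(t | P t) w t -> exists2 t, P t & f t <= C / M.
Proof.
move=> f0 fC /andP[M0 MP].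
have [t0 Pt0 _] : exists2 t, P t & ~~ pred0 t.
  by apply: heavier_witness; rewrite big_pred0//; exact: lt_le_trans MP.
have [t Pt tmin] := @arg_minP _ _ _ t0 P f Pt0.
exists t => //; rewrite ler_pdivlMr//; apply: le_trans fC.
apply: (le_trans (ler_wpM2l (f0 t) MP)); rewrite mulr_sumr big_mkcond/=.
apply: ler_sum => s _; case: ifP => [Ps|_]; last by rewrite mulr_ge0.
by rewrite mulrC ler_wpM2l// tmin.
Qed.

End WeightSums.

(** * One-point extension of a map that is Lipschitz off a sparse graph *)

Section RobustExtension.
Variables (R : realType) (T : finType) (d m : nat).
Variables (x : T -> 'rV[R]_d) (y : T -> 'rV[R]_m) (w : T -> R) (c : 'rV[R]_d).
Variables (E : rel T) (L alpha beta : R).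
Hypotheses (w_ge0 : forall t, 0 <= w t) (W_gt0 : 0 < \sum_t w t).
Hypotheses (L_ge0 : 0 <= L) (alpha_ge0 : 0 <= alpha) (beta_gt0 : 0 < beta).
Hypothesis E_sym : symmetric E.
Hypothesis E_sparse : everywhere_sparse w alpha E.
Hypothesis y_lipschitz : forall s t, ~~ E s t ->
  enorm (y s - y t) <= L * enorm (x s - x t).

Let W := \sum_t w t.
Let r t := enorm (x t - c).
Let r_ge0 t : 0 <= r t. Proof. exact: enorm_ge0. Qed.

(** Points so close to [c] that two neighbourhoods may cover everything at least as close. Their
    total weight is at most [2 * alpha * W] by [small_sublevel_weight]. *)
Let central t := \sum_(s | r s <= r t) w s <= 2 * alpha * W.

(* Any two points have common non-neighbours of weight [(1 - 2 * alpha) * W],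
   hence one that is no farther from [c] than a non-central point. *)
Lemma noncentral_pair_bound s t : ~~ central s -> ~~ central t ->
  enorm (y s - y t) <= 2 * L * (r s + r t).
Proof.
wlog st : s t / r s <= r t => [H|] sS tS.
  have [st|/ltW ts] := leP (r s) (r t); first exact: H.
  by rewrite enormB (addrC (r s)); exact: H.
have [u ru] : exists2 u, r u <= r s & ~~ (E s u || E t u).
  apply: (heavier_witness w_ge0); apply: (@le_lt_trans _ _ (2 * alpha * W)).
    apply: le_trans (weight_union w_ge0 _ _) _.
    by have := E_sparse s; have := E_sparse t; rewrite -/W; lra.
  by rewrite ltNge.
rewrite negb_or => /andP[su tu].
(* The path through [u], measured in [x] via [c], has length at most
   [r s + r t + 2 * r u <= 3 * r s + r t], and [r s <= r t] balances this to [2 * (r s + r t)]. *)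
have := enorm_triangleB (y s) (y u) (y t); rewrite (enormB (y u)).
have := y_lipschitz su; have := y_lipschitz tu.
have := enorm_triangleB (x s) c (x u); have := enorm_triangleB (x t) c (x u).
rewrite (enormB c) -!/(r _) => h1 h2.
have := ler_wpM2l L_ge0 h1; have := ler_wpM2l L_ge0 h2; have := ler_wpM2l L_ge0 ru.
have := ler_wpM2l L_ge0 st.
by lra.
Qed.

(** Under this cap a neighbourhood has mass at most [alpha / beta], yet any noncentral set of weight
    at least [beta * W] can carry all the mass. Excluding central points makes
    [noncentral_pair_bound] available throughout the support. *)
Let cap t := if central t then 0 else w t / (beta * W).

(** Compare the pairwise sums of [y] and [x] from [wmean_pairwise]: off [E] the Lipschitz bound
    applies, and on [E] the small degree makes the error proportional to [alpha / beta]. *)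
Lemma capped_distribution_variance l : capped_distribution cap l ->
  \sum_t l t * enorm (y t - wmean l y) ^+ 2 <=
  L ^+ 2 * (1 + 8 * (alpha / beta)) * \sum_t l t * r t ^+ 2.
Proof.
move=> [lcap l1].
have l_ge0 t : 0 <= l t by have /andP[] := lcap t.
have l_central t : central t -> l t = 0.
  by move=> ct; have := lcap t; rewrite /cap ct -eq_le => /eqP.
pose e s t : R := (E s t)%:R.
have pair s t : l s * l t * enorm (y s - y t) ^+ 2 <=
    L ^+ 2 * (l s * l t * enorm (x s - x t) ^+ 2) +
    8 * L ^+ 2 * (e s t * l s * l t * r s ^+ 2 + e s t * l s * l t * r t ^+ 2).
  have ll : 0 <= l s * l t by rewrite mulr_ge0.
  have := sqr_ge0 (r s); have := sqr_ge0 (r t); have := sqr_ge0 L.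
  have := sqr_ge0 (enorm (x s - x t)).
  rewrite /e; case: (boolP (E s t)) => [_|/y_lipschitz]; last first.
    move=> h ? ? ? ?; rewrite !mul0r addr0 mulr0 addr0.
    rewrite [leRHS]mulrCA ler_wpM2l// -exprMn ler_pXn2r// nnegrE ?enorm_ge0//.
    by rewrite mulr_ge0// enorm_ge0.
  move=> h1 h2 h3 h4; rewrite !mul1r.
  case: (boolP (central s)) => [cs|cs].
    by rewrite (l_central s cs) !mul0r !mulr0 !addr0 mulr0.
  case: (boolP (central t)) => [ct|ct].
    by rewrite (l_central t ct) !mulr0 !mul0r !mulr0 !addr0 mulr0.
  (* The [8] is [2 ^+ 2] from [noncentral_pair_bound] times [2] from
     [(a + b) ^+ 2 <= 2 * (a ^+ 2 + b ^+ 2)]. *)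
  have h : enorm (y s - y t) ^+ 2 <= 8 * L ^+ 2 * (r s ^+ 2 + r t ^+ 2).
    apply: (@le_trans _ _ ((2 * L * (r s + r t)) ^+ 2)).
      rewrite ler_pXn2r ?nnegrE ?enorm_ge0 ?noncentral_pair_bound//.
      by rewrite !mulr_ge0 ?addr_ge0.
    by have := mulr_ge0 h2 (sqr_ge0 (r s - r t)); nra.
  apply: (le_trans (ler_wpM2l ll h)).
  have : 0 <= L ^+ 2 * (l s * l t * enorm (x s - x t) ^+ 2).
    exact: mulr_ge0 h2 (mulr_ge0 ll h1).
  by lra.
have degree s : \sum_t e s t * l t <= alpha / beta.
  apply: (@le_trans _ _ (\sum_(t | E s t) w t / (beta * W))).
    rewrite [leRHS]big_mkcond/=; apply: ler_sum => t _; rewrite /e.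
    case: ifP => _; last by rewrite mul0r.
    rewrite mul1r; have /andP[_ /le_trans] := lcap t; apply; rewrite /cap.
    by case: ifP => // _; rewrite divr_ge0// mulr_ge0// ltW.
  by rewrite -mulr_suml ler_pdivrMr ?mulr_gt0// mulrA divfK ?gt_eqF//.
have bad : \sum_s \sum_t e s t * l s * l t * r s ^+ 2 <=
    alpha / beta * \sum_t l t * r t ^+ 2.
  rewrite mulr_sumr; apply: ler_sum => s _.
  have -> : \sum_t e s t * l s * l t * r s ^+ 2 =
      (\sum_t e s t * l t) * (l s * r s ^+ 2).
    by rewrite mulr_suml; apply: eq_bigr => t _; ring.
  by rewrite ler_wpM2r// mulr_ge0// sqr_ge0.
(* By symmetry of [E] the two error sums agree; the resulting factor [2] cancels with the one in
   [wmean_pairwise]. *)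
have badC : \sum_s \sum_t e s t * l s * l t * r t ^+ 2 =
    \sum_s \sum_t e s t * l s * l t * r s ^+ 2.
  rewrite exchange_big/=; apply: eq_bigr => s _; apply: eq_bigr => t _.
  by rewrite /e E_sym; ring.
have Ey := wmean_pairwise y (wmean l y) l1.
have Ex := wmean_pairwise x c l1.
have : \sum_s \sum_t l s * l t * enorm (y s - y t) ^+ 2 <=
    L ^+ 2 * (\sum_s \sum_t l s * l t * enorm (x s - x t) ^+ 2) + 8 * L ^+ 2 *
    (\sum_s \sum_t e s t * l s * l t * r s ^+ 2 +
     \sum_s \sum_t e s t * l s * l t * r t ^+ 2).
  rewrite -big_split !mulr_sumr -big_split/=; apply: ler_sum => s _.
  rewrite -big_split !mulr_sumr -big_split/=; apply: ler_sum => t _.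
  exact: pair.
rewrite badC Ey Ex subrr (_ : enorm 0 = 0); last first.
  by rewrite /enorm big1 ?sqrtr0// => i _; rewrite mxE expr0n.
rewrite expr0n subr0.
have := ler_wpM2l (sqr_ge0 L) bad.
(* The displacement of the mean of [x] from [c] enters with a negative sign and is dropped. *)
have : 0 <= L ^+ 2 * enorm (wmean l x - c) ^+ 2 by rewrite mulr_ge0 ?sqr_ge0.
by rewrite -/(r _) /r; lra.
Qed.

(** If noncentral violators weighed more than [beta * W], normalising [w] on them would give a
    competitor of positive value, whereas the variance bound makes the optimal value nonpositive.
    Central points account for the remaining [2 * alpha * W]. *)
Lemma robust_one_point_extension : 2 * alpha + beta <= 1 ->
  exists c' : 'rV[R]_m,
    \sum_(t | L ^+ 2 * (1 + 8 * (alpha / beta)) * r t ^+ 2 < enorm (y t - c') ^+ 2)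
      w t <= (2 * alpha + beta) * W.
Proof.
move=> ab1; pose k t := L ^+ 2 * (1 + 8 * (alpha / beta)) * r t ^+ 2.
have central_weight : \sum_(t | central t) w t <= 2 * alpha * W.
  by apply: small_sublevel_weight => //; rewrite !mulr_ge0// ltW.
have uniform (P : pred T) : (forall t, P t -> ~~ central t) ->
    beta * W <= \sum_(t | P t) w t ->
    capped_distribution cap
      (fun t => if P t then w t / \sum_(s | P s) w s else 0).
  move=> Pc Pw; have bW : 0 < beta * W by rewrite mulr_gt0.
  have P0 := lt_le_trans bW Pw; split=> [t|].
    rewrite /cap; case: ifP => [/Pc /negbTE ->|_]; last first.
      by rewrite lexx/=; case: ifP => // _; rewrite divr_ge0// ltW.
    rewrite divr_ge0 ?(ltW P0)//= ler_wpM2l//.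
    by rewrite lef_pV2 ?posrE.
  by rewrite -big_mkcond/= -mulr_suml divff// gt_eqF.
(* Feasibility: [2 * alpha + beta <= 1] leaves noncentral weight at least [beta * W]. *)
have [|l lcap lmax] := @quadratic_minimax _ _ cap k _ y
    (fun t => if ~~ central t then w t / \sum_(s | ~~ central s) w s else 0).
  apply: uniform => //.
  have := weight_compl w central; rewrite -/W => WE.
  have := ler_wpM2r (ltW W_gt0) ab1; rewrite -/W; lra.
set c' := wmean l y in lmax; exists c'; rewrite -/(k _).
pose V t := ~~ central t && (k t < enorm (y t - c') ^+ 2).
have VW : \sum_(t | V t) w t <= beta * W.
  rewrite leNgt; apply/negP => bV.
  have V0 : 0 < \sum_(t | V t) w t by apply: lt_trans bV; rewrite mulr_gt0.
  have Vc t : V t -> ~~ central t by move=> /andP[].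
  have := lmax _ (uniform V Vc (ltW bV)).
  have : \sum_t l t * (enorm (y t - c') ^+ 2 - k t) <= 0.
    under eq_bigr do rewrite mulrBr.
    rewrite sumrB subr_le0 (le_trans (capped_distribution_variance lcap))//.
    by rewrite mulr_sumr; apply: ler_sum => t _; rewrite mulrCA.
  move=> /[swap] /le_trans /[apply]; rewrite leNgt => /negP; apply.
  (* A violator of positive weight makes the competitor's value strictly positive. *)
  have [t Vt wt0] : exists2 t, V t & ~~ (w t <= 0).
    apply: (heavier_witness w_ge0); rewrite big1// => t wt.
    by apply/eqP; rewrite eq_le wt w_ge0.
  rewrite (bigD1 t)//= Vt ltr_pwDl//.
    rewrite mulr_gt0 ?divr_gt0 ?subr_gt0//; last by case/andP: Vt.
    by rewrite ltNge.
  apply: sumr_ge0 => s _; case: ifP => [Vs|_]; last by rewrite mul0r.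
  rewrite mulr_ge0 ?divr_ge0 ?(ltW V0)// subr_ge0 ltW//.
  by case/andP: Vs.
apply: (@le_trans _ _ (\sum_(t | central t || V t) w t)).
  by apply: weight_subset => // t kt; rewrite /V kt andbT orbN.
by apply: le_trans (weight_union w_ge0 _ _) _; lra.
Qed.

End RobustExtension.

(** * Convexity estimates for real powers *)

Section PowerInequalities.
Variable R : realType.
Implicit Types a b p t : R.

Lemma powR_conv p t a b : 1 <= p -> 0 <= t <= 1 -> 0 <= a -> 0 <= b ->
  ((1 - t) * a + t * b) `^ p <= (1 - t) * a `^ p + t * b `^ p.
Proof.
move=> p1 /andP[t0 t1] a0 b0.
have := @convex_powR R p p1 (Itv01 t0 t1) b a.
rewrite !inE/= !in_itv/= !andbT => /(_ b0 a0).
by move=> h; rewrite addrC [leRHS]addrC; exact: h.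
Qed.

(** Convexity applied to [a + b = (1 - t) * (a / (1 - t)) + t * (b / t)]. The large coefficient
    [t^(1-p)] is affordable on a set of relative weight about [t^p], where it costs only [O(t)]. *)
Lemma powR_add_le p t a b : 1 <= p -> 0 < t < 1 -> 0 <= a -> 0 <= b ->
  (a + b) `^ p <= (a / (1 - t)) `^ p + t / t `^ p * b `^ p.
Proof.
move=> p1 /andP[t0 t1] a0 b0; have t1' : 0 < 1 - t by rewrite subr_gt0.
have -> : a + b = (1 - t) * (a / (1 - t)) + t * (b / t).
  by field; rewrite !gt_eqF.
have at0 : 0 <= a / (1 - t) by rewrite divr_ge0// ltW.
have bt0 : 0 <= b / t by rewrite divr_ge0// ltW.
apply: (le_trans (powR_conv p1 _ at0 bt0)); first by rewrite !ltW.
apply: lerD; first by rewrite ler_piMl ?powR_ge0// gerBl ltW.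
rewrite -{2}[b](divfK (lt0r_neq0 t0)) (powRM p bt0 (ltW t0)).
by rewrite [_ * t `^ p]mulrC mulrA divfK// gt_eqF// powR_gt0.
Qed.

(** A ratio [a / b <= 1] only decreases under the power [p >= 1]. This converts other bases to
    [3]. *)
Lemma powR_scale_le p a b : 1 <= p -> 0 < a <= b -> a `^ p <= a / b * b `^ p.
Proof.
move=> p1 /andP[a0 ab]; have b0 := lt_le_trans a0 ab.
rewrite -{1}[a](divfK (lt0r_neq0 b0)) powRM ?divr_ge0 ?(ltW a0) ?(ltW b0)//.
rewrite ler_wpM2r ?powR_ge0// -[leRHS]powRr1 ?divr_ge0 ?(ltW a0) ?(ltW b0)//.
by apply: ger_powR => //; rewrite divr_gt0//= ler_pdivrMr// mul1r.
Qed.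

(** Convexity between [1] and [7 / 5], the values of [1 + 4 * t] at [0] and [1 / 10]; the [5] covers
    [10 * (7 / 5) / 3]. *)
Lemma powR_1D4_le p t : 1 <= p -> 0 <= t <= 1 / 10 ->
  (1 + 4 * t) `^ p <= 1 + 5 * 3 `^ p * t.
Proof.
move=> p1 t01.
have -> : 1 + 4 * t = (1 - 10 * t) * 1 + 10 * t * (7 / 5) by field.
apply: (le_trans (powR_conv p1 _ _ _)) => //; [lra|].
have := @powR_scale_le p (7 / 5) 3 p1 ltac:(lra).
have := powR_ge0 3 p; rewrite powR1; nra.
Qed.

End PowerInequalities.

(** * Comparison of costs under a map that is Lipschitz off a sparse graph *)

Section CostBound.
Variables (R : realType) (T : finType) (d m : nat) (p : R).
Variables (x : T -> 'rV[R]_d) (y : T -> 'rV[R]_m) (w : T -> R).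
Variables (E : rel T) (L : R).
Hypotheses (p_ge1 : 1 <= p) (w_ge0 : forall t, 0 <= w t) (L_ge0 : 0 <= L).
Hypothesis E_sym : symmetric E.
Hypothesis y_lipschitz : forall s t, ~~ E s t ->
  enorm (y s - y t) <= L * enorm (x s - x t).

(** Up to the factor [L^p], each point pays [(1 + 4 * th)^p] times its own share, plus an additive
    [K] per unit weight if exceptional; the exceptional weight cancels the factor [1 / b] in [K]. *)
Lemma sparse_cost_at_bound (c : 'rV[R]_d) (th : R) :
  0 < \sum_t w t -> 0 < th <= 1 / 10 -> everywhere_sparse w (th * th `^ p) E ->
  exists c' : 'rV[R]_m,
    cost_at p w y c' <= L `^ p * (1 + 9 * 3 `^ p * th) * cost_at p w x c.
Proof.
move=> W_gt0 /andP[th0 th1] sparse; set W := \sum_t w t in W_gt0.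
set b := th `^ p in sparse; set C := cost_at p w x c.
have p0 : 0 <= p by apply: le_trans p_ge1.
have b0 : 0 < b by rewrite powR_gt0.
have bth : b <= th.
  by rewrite -[leRHS]powRr1 ?(ltW th0)//; apply: ger_powR => //; lra.
have a0 : 0 <= th * b by rewrite mulr_ge0 ?ltW.
have ab : 2 * (th * b) + b <= 1 by nra.
have [c' bad_weight] := robust_one_point_extension c w_ge0 W_gt0 L_ge0 a0 b0
  E_sym sparse y_lipschitz ab.
exists c'; rewrite mulfK ?gt_eqF// -/W in bad_weight.
pose r t := enorm (x t - c); pose rho t := enorm (y t - c').
pose bad t := L ^+ 2 * (1 + 8 * th) * r t ^+ 2 < rho t ^+ 2.
have r_ge0 t : 0 <= r t by exact: enorm_ge0.
have rho_ge0 t : 0 <= rho t by exact: enorm_ge0.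
(* Uses [1 + 8 * th <= (1 + 4 * th) ^+ 2]. *)
have good t : ~~ bad t -> rho t <= L * ((1 + 4 * th) * r t).
  rewrite /bad -leNgt => h.
  have z0 : 0 <= L * ((1 + 4 * th) * r t) by rewrite !mulr_ge0//; lra.
  rewrite -(@ler_pXn2r _ 2)// ?nnegrE//; apply: (le_trans h).
  rewrite mulrA !exprMn ler_wpM2r ?sqr_ge0// ler_wpM2l ?sqr_ge0//; nra.
have C_ge0 : 0 <= C by apply: sumr_ge0 => t _; rewrite mulr_ge0 ?powR_ge0.
(* At least [87 / 100] of the weight is good and not adjacent to a given [t]: [b] removes at most
   [1 / 10], and three times [th * b] at most [3 / 100]. *)
pose A := C / (87 / 100 * W).
have A_ge0 : 0 <= A by rewrite divr_ge0// mulr_ge0 ?(ltW W_gt0)//; lra.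
(* Of the [12 / 5], [1] comes from the distance between [x t] and [x u] via [c], and
   [7 / 5 >= 1 + 4 * th] from [rho u]. *)
have far t : exists2 u, r u `^ p <= A & rho t <= L * (r t + 12 / 5 * r u).
  have [u] : exists2 u, ~~ (bad u || E t u) & r u `^ p <= A.
    apply: (le_average_witness w_ge0) => [s||]; [exact: powR_ge0|exact: lexx|].
    have := weight_compl w (fun u => bad u || E t u).
    have := weight_union w_ge0 bad (E t).
    have := sparse t; rewrite -/W => h1 h2 h3; move: bad_weight => h4.
    have : th * b * W <= 1 / 100 * W by rewrite ler_wpM2r ?(ltW W_gt0)//; nra.
    have : b * W <= 1 / 10 * W by rewrite ler_wpM2r ?(ltW W_gt0)//; lra.
    by rewrite -/(bad _) in h4; lra.
  rewrite negb_or => /andP[/good gu tu] rA; exists u => //.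
  have := enorm_triangleB (y t) (y u) c'; rewrite -!/(rho _).
  have := y_lipschitz tu.
  have := ler_wpM2l L_ge0 (enorm_triangleB (x t) c (x u)).
  rewrite (enormB c) -!/(r _).
  have : L * (4 * th * r u) <= L * (2 / 5 * r u).
    by rewrite ler_wpM2l// ler_wpM2r//; lra.
  lra.
pose K := th / b * ((12 / 5) `^ p * A).
have K_ge0 : 0 <= K.
  exact: mulr_ge0 (divr_ge0 (ltW th0) (ltW b0)) (mulr_ge0 (powR_ge0 _ _) A_ge0).
have term t : rho t `^ p <=
    L `^ p * ((1 + 4 * th) `^ p * r t `^ p + if bad t then K else 0).
  have pos1 : 0 <= 1 + 4 * th by lra.
  case: ifPn => [_|/good gt]; last first.
    rewrite addr0 -powRM// -powRM ?mulr_ge0//.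
    by apply: ge0_ler_powR; rewrite ?nnegrE ?mulr_ge0.
  have [u uA ut] := far t.
  have pos2 : 0 <= 12 / 5 * r u by rewrite mulr_ge0//; lra.
  apply: (@le_trans _ _ ((L * (r t + 12 / 5 * r u)) `^ p)).
    by apply: ge0_ler_powR; rewrite ?nnegrE ?mulr_ge0 ?addr_ge0.
  rewrite powRM ?addr_ge0// ler_wpM2l ?powR_ge0//.
  apply: (le_trans (@powR_add_le _ p th _ _ p_ge1 _ _ _)) => //; first by lra.
  apply: lerD.
    (* Since [1 / (1 - th) <= 1 + 4 * th], exceptional points get the same leading factor as good
       ones. *)
    rewrite -powRM//; apply: ge0_ler_powR; rewrite ?nnegrE ?mulr_ge0//.
      by rewrite invr_ge0; lra.
    by rewrite mulrC ler_wpM2r// -[leLHS]mul1r ler_pdivrMr; nra.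
  rewrite -/b ler_wpM2l//; first by rewrite divr_ge0 ?ltW.
  by rewrite powRM// ?ler_wpM2l ?powR_ge0//; lra.
apply: (@le_trans _ _ (L `^ p * ((1 + 4 * th) `^ p * C + K * \sum_(t | bad t) w t))).
  rewrite /C /cost_at !mulr_sumr [X in _ + X]big_mkcond -big_split mulr_sumr/=.
  apply: ler_sum => t _; apply: (le_trans (ler_wpM2l (w_ge0 t) (term t))).
  rewrite -/(r _) le_eqVlt; apply/orP; left; apply/eqP.
  by case: ifP => _; ring.
rewrite -mulrA ler_wpM2l ?powR_ge0//.
have h1 := ler_wpM2r C_ge0 (@powR_1D4_le _ p th p_ge1 ltac:(lra)).
(* The [6 / 5] bounds [1 + 2 * th]; [b] and [W] cancel against [K]. *)
have h2 : K * \sum_(t | bad t) w t <= 6 / 5 * (100 / 87) * (12 / 5) `^ p * th * C.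
  apply: (@le_trans _ _ (K * (6 / 5 * b * W))).
    rewrite ler_wpM2l//; apply: (le_trans bad_weight).
    by rewrite ler_wpM2r ?(ltW W_gt0)//; nra.
  rewrite /K /A le_eqVlt; apply/orP; left; apply/eqP; field.
  by rewrite !gt_eqF.
(* With [(12 / 5)^p <= (4 / 5) * 3^p] the exceptional part is below [2 * 3^p * th * C]; adding the
   [5] from [powR_1D4_le] stays within [9]. *)
have h3 := ler_wpM2r (mulr_ge0 (ltW th0) C_ge0) (@powR_scale_le _ p (12 / 5) 3 p_ge1 ltac:(lra)).
have h4 : 0 <= 3 `^ p * (th * C).
  exact: mulr_ge0 (powR_ge0 _ _) (mulr_ge0 (ltW th0) C_ge0).
lra.
Qed.

Lemma sparse_cost_bound (alpha : R) :
  everywhere_sparse w alpha E -> alpha <= 1 / 10 `^ (p + 1) ->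
  cost p w y <=
  L `^ p * (1 + 3 `^ (p + 2) * alpha `^ (1 / (p + 1))) * cost p w x.
Proof.
move=> sparse alpha_le.
have p1_gt0 : 0 < p + 1 by move: p_ge1; lra.
have [c' -> c'min] := cost_attained y p_ge1 w_ge0.
have [c -> _] := cost_attained x p_ge1 w_ge0.
have C_ge0 : 0 <= cost_at p w x c.
  by apply: sumr_ge0 => t _; rewrite mulr_ge0 ?powR_ge0.
have -> : 3 `^ (p + 2) = 9 * 3 `^ p :> R.
  rewrite powRD; last by rewrite pnatr_eq0 implybT.
  by rewrite -[2]/(2%:R) powR_mulrn// mulrC; ring.
(* Zero total weight forces every weight, and so the left-hand cost, to vanish. *)
have [W0|] := leP (\sum_t w t) 0.
  have w0 t : w t = 0.
    apply/eqP; rewrite eq_le w_ge0 (le_trans _ W0)//.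
    by rewrite (bigD1 t)//= lerDl sumr_ge0.
  rewrite {1}/cost_at big1 => [|t _]; last by rewrite w0 mul0r.
  by rewrite !mulr_ge0 ?addr_ge0 ?mulr_ge0 ?powR_ge0.
move=> W0; set W := \sum_t w t in W0.
have [t0 _ _] : exists2 t, predT t & ~~ @pred0 T t.
  by apply: (heavier_witness w_ge0); rewrite big_pred0.
(* Sparsity at the single vertex [t0] already forces this sign, as [W] is positive. *)
have alpha_ge0 : 0 <= alpha.
  have := le_trans (sumr_ge0 _ (fun t _ => w_ge0 t)) (sparse t0).
  by rewrite pmulr_lge0.
have bound th : 0 < th <= 1 / 10 -> alpha <= th * th `^ p ->
    cost_at p w y c' <= L `^ p * (1 + 9 * 3 `^ p * th) * cost_at p w x c.
  move=> th01 ath; have [|z hz] := @sparse_cost_at_bound c th W0 th01.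
    by move=> u; apply: le_trans (sparse u) _; rewrite ler_wpM2r// ltW.
  exact: le_trans (c'min z) hz.
have powK (a : R) : 0 <= a -> (a `^ (p + 1)) `^ (1 / (p + 1)) = a.
  by move=> a0; rewrite -powRrM mulrC divfK ?gt_eqF// powRr1.
have powE (a : R) : 0 < a -> a * a `^ p = a `^ (p + 1).
  by move=> a0; rewrite powRD ?powRr1 ?(ltW a0) 1?mulrC// (gt_eqF a0) implybT.
move: alpha_ge0; rewrite le_eqVlt => /predU1P[a0|a0]; last first.
  apply: bound.
    rewrite powR_gt0//=.
    rewrite -[leRHS]powK; last lra.
    apply: ge0_ler_powR; rewrite ?nnegrE ?powR_ge0 ?(ltW a0)//.
      by rewrite divr_ge0// ltW.
    apply: le_trans alpha_le _.
    by rewrite ler_pdivrMr ?powR_gt0// -powRM// divfK// powR1.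
  rewrite powE ?powR_gt0// -powRrM divfK ?gt_eqF//.
  by rewrite powRr1// ltW.
rewrite -a0 powR0 ?mulr0 ?addr0 ?mulr1; last by rewrite gt_eqF// divr_gt0.
(* For [alpha = 0] the root is [0], but [bound] asks for [th > 0]; so [th] tends to [0], with [B]
   the coefficient of [th] in the bound. *)
apply/ler_addgt0Pr => e e0.
set B := L `^ p * (9 * 3 `^ p) * cost_at p w x c.
have B0 : 0 <= B by rewrite !mulr_ge0 ?powR_ge0.
pose th := Num.min (1 / 10) (e / (B + 1)).
have th0 : 0 < th by rewrite lt_min; apply/andP; split; [|apply: divr_gt0]; lra.
have the : th * (B + 1) <= e by rewrite -ler_pdivlMr ?ge_min ?lexx ?orbT//; lra.
have th10 : th <= 1 / 10 by rewrite ge_min lexx.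
have := bound th; rewrite th0 th10 -a0 mulr_ge0 ?powR_ge0 ?(ltW th0)//.
by move=> /(_ isT isT); rewrite /B in the *; lra.
Qed.

End CostBound.

Theorem theorem13 (R : realType) (d m : nat) (p eps alpha : R)
    (X : {fset 'rV[R]_d}) (w : X -> R) (phi : X -> 'rV[R]_m) :
  1 <= p ->
  0 < eps ->
  (forall x : X, 0 <= w x) ->
  everywhere_sparse w alpha (distortion_graph eps (fun x : X => val x) phi) ->
  alpha <= 1 / 10 `^ (p + 1) ->
  let D := (1 + eps) `^ p * (1 + 3 `^ (p + 2) * alpha `^ (1 / (p + 1))) in
  1 / D * cost p w (fun x : X => val x) <= cost p w phi /\
  cost p w phi <= D * cost p w (fun x : X => val x).
Proof.
move=> p1 eps0 w0 sparse alpha_le D.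
have L0 : 0 < 1 + eps by lra.
have D0 : 0 < D.
  by rewrite mulr_gt0 ?powR_gt0// ltr_pwDl// mulr_ge0 ?powR_ge0.
have E_sym : symmetric (distortion_graph eps (fun x : X => val x) phi).
  by move=> s t; rewrite /distortion_graph (enormB (val s)) (enormB (phi s)).
split; last first.
  apply: sparse_cost_bound sparse alpha_le => // [|s t]; first exact: ltW.
  by rewrite /distortion_graph negbK => /andP[].
(* The lower bound is the upper bound with the two point sets exchanged: off the same graph, the
   inverse map is also [(1 + eps)]-Lipschitz. *)
rewrite div1r -ler_pdivlMl ?invr_gt0// invrK.
apply: sparse_cost_bound sparse alpha_le => // [|s t]; first exact: ltW.
by rewrite /distortion_graph negbK => /andP[h _]; rewrite -ler_pdivrMl.
Qed.
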